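(* For every constant $c>0$ there exist two oblique triangular bipyramids $P$ and $Q$ in Euclidean 3-space $\mathbb{R}^3$ such that: (i) $P$ is convex and encloses a non-zero volume, i.e. $\operatorname{vol} P>0$; (ii) $Q$ is nonconvex and intrinsically isometric to $P$; and (iii) $\operatorname{vol} Q> c\cdot \operatorname{vol} P$.
   Context: A polyhedral surface (or polyhedron) means a compact boundary-free polyhedral surface in Euclidean 3-space. A polyhedral surface is called convex if it is the boundary of a convex set, and nonconvex otherwise. A (triangular) bipyramid is any polyhedral surface combinatorially equivalent to the boundary of the convex hull of a regular tetrahedron and its image under reflection in one of its faces. Thus it has 5 vertices, 9 edges and 6 triangular faces: two apexes, each joined to the three vertices of a ''base'' triangle (which is not itself a face), the apexes not being joined to each other by an edge. The faces are the six triangles spanned by one apex and one side of the base triangle. A bipyramid is called oblique if it is not a right bipyramid; it is right if the line through its two apexes is perpendicular to the plane of the base triangle and passes through the centroid of the base triangle. Two polyhedral surfaces $p$ and $q$ are intrinsically isometric if there exists a one-to-one correspondence (bijection) $f:p\to q$ that preserves the length of every curve. Such an $f$ is not required to map edges to edges or faces to faces. For such a surface $p$, $\operatorname{vol} p$ denotes the 3-dimensional volume enclosed by $p$. *)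

(* Defs.v *)
From HB Require Import structures.
From mathcomp Require Import all_boot all_order all_algebra.
From mathcomp Require Import all_classical all_reals all_analysis.
Import Order.TTheory GRing.Theory Num.Theory.
Import numFieldNormedType.Exports.

Set Implicit Arguments.
Unset Strict Implicit.
Unset Printing Implicit Defensive.

Local Open Scope classical_set_scope.
Local Open Scope ring_scope.

(* The topology of 'rV[R]_3 in the library is that of the max norm, which is
   equivalent to the Euclidean norm; lengths and angles must use [dot]. *)
Definition dot (R : realType) (u v : 'rV[R]_3) : R :=
  \sum_(i < 3) u ord0 i * v ord0 i.

Definition eucl_dist (R : realType) (u v : 'rV[R]_3) : R :=
  Num.sqrt (dot (u - v) (u - v)).

Definition hull (R : realType) (V : finType) (v : V -> 'rV[R]_3) (A : {set V}) :
    set 'rV[R]_3 :=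
  [set x | exists w : V -> R,
    [/\ forall k, 0 <= w k, \sum_(k in A) w k = 1
      & x = \sum_(k in A) w k *: v k]].

Definition affinely_independent (R : realType) (V : finType)
    (v : V -> 'rV[R]_3) (A : {set V}) : Prop :=
  forall w : V -> R,
    \sum_(k in A) w k = 0 -> \sum_(k in A) w k *: v k = 0 ->
    forall k, k \in A -> w k = 0.

(* [v] embeds in R^3, with flat nondegenerate faces, the triangulated surface
   with vertex set [V] and triangles [F]. By the last condition no two
   triangles with a common side are coplanar, so that the triangles are the
   faces of the embedded surface and their sides are its edges. *)
Definition realizes (R : realType) (V : finType) (F : {set {set V}})
    (v : V -> 'rV[R]_3) : Prop :=
  [/\ forall A, A \in F -> affinely_independent v A,
      forall A B, A \in F -> B \in F ->
        hull v A `&` hull v B = hull v (A :&: B)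
    & forall A B, A \in F -> B \in F -> #|A :&: B| = 2%N ->
        affinely_independent v (A :|: B)].

(* [inl s] are the two apexes, [inr j] the three vertices of the base. *)
Notation bipyramid_vertex := (bool + 'I_3)%type.

Definition bipyramid_face (s : bool) (i : 'I_3) : {set bipyramid_vertex} :=
  [set k | match k with inl s' => s' == s | inr j => j != i end].

Definition bipyramid_faces : {set {set bipyramid_vertex}} :=
  [set bipyramid_face x.1 x.2 | x : bool * 'I_3].

Record bipyramid (R : realType) := Bipyramid {
  vertex : bipyramid_vertex -> 'rV[R]_3;
  vertexP : realizes bipyramid_faces vertex }.

Definition surface (R : realType) (P : bipyramid R) : set 'rV[R]_3 :=
  \bigcup_(A in [set A | A \in bipyramid_faces]) hull (vertex P) A.

Definition apex (R : realType) (P : bipyramid R) (s : bool) : 'rV[R]_3 :=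
  vertex P (inl s).

Definition base (R : realType) (P : bipyramid R) (j : 'I_3) : 'rV[R]_3 :=
  vertex P (inr j).

Definition right_bipyramid (R : realType) (P : bipyramid R) : Prop :=
  (forall i j, dot (apex P true - apex P false) (base P i - base P j) = 0) /\
  (exists t : R, 3^-1 *: (\sum_(j < 3) base P j)
                 = apex P false + t *: (apex P true - apex P false)).

Definition oblique (R : realType) (P : bipyramid R) : Prop :=
  ~ right_bipyramid P.

Definition convex_surface (R : realType) (p : set 'rV[R]_3) : Prop :=
  exists K : set 'rV[R]_3, convex_set K /\ p = closure K `\` K°.

(* A point is enclosed by [p] when it lies in a bounded connected component of
   the complement of [p]. *)
Definition enclosed (R : realType) (p : set 'rV[R]_3) : set 'rV[R]_3 :=
  [set x | (~` p) x /\ bounded_set (connected_component (~` p) x)].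

Definition point3 (R : realType) (x : R * R * R) : 'rV[R]_3 :=
  \row_(i < 3) [:: x.1.1; x.1.2; x.2]`_i.

Definition lebesgue3 (R : realType) (A : set 'rV[R]_3) : \bar R :=
  ((@lebesgue_measure R \x @lebesgue_measure R) \x @lebesgue_measure R)%E
    (@point3 R @^-1` A).

Definition volume (R : realType) (p : set 'rV[R]_3) : \bar R :=
  lebesgue3 (enclosed p).

Definition curve_in (R : realType) (p : set 'rV[R]_3) (a b : R)
    (g : R -> 'rV[R]_3) : Prop :=
  {within `[a, b], continuous g} /\ (forall t, t \in `[a, b] -> p (g t)).

(* A partition a = t_0 < t_1 < ... < t_n = b is given by s = t_1, ..., t_n. *)
Definition curve_length (R : realType) (a b : R) (g : R -> 'rV[R]_3) : \bar R :=
  ereal_sup [set (\sum_(0 <= k < size s)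
                    eucl_dist (g (nth b (a :: s) k)) (g (nth b s k)))%:E
            | s in itv_partition a b].

(* The curve [f \o g] is required to be continuous, and may have infinite
   length, in which case so does [g]. *)
Definition intrinsically_isometric (R : realType) (p q : set 'rV[R]_3) : Prop :=
  exists f : 'rV[R]_3 -> 'rV[R]_3,
    set_bij p q f /\
    (forall (a b : R) (g : R -> 'rV[R]_3), a < b -> curve_in p a b g ->
       curve_in q a b (f \o g) /\
       curve_length a b (f \o g) = curve_length a b g).

(* Main.v *)
Require Import Defs.
From mathcomp Require Import all_boot all_order all_algebra.
From mathcomp Require Import all_classical all_reals all_analysis.
From mathcomp Require Import measurable_realfun ring lra.
Import Order.TTheory GRing.Theory Num.Theory.
Import numFieldNormedType.Exports.

Set Implicit Arguments.
Unset Strict Implicit.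
Unset Printing Implicit Defensive.

Local Open Scope classical_set_scope.
Local Open Scope ring_scope.

(* Both bipyramids have base vertices (0,0,0), (p,q,0), (p,-q,0) and apexes
   (X,0,Z), (X,0,-Z).  In the coordinates eta = y/q, zeta = z/Z and
   u = (x - X|zeta|)/p the enclosed region is |eta| < u < 1 - |zeta|, and the
   piecewise affine map that exchanges eta and zeta and replaces u by
   u + |zeta| - |eta| carries one such surface to another: the apexes go to
   base vertices and two base vertices go to the apexes.  It is an isometry on
   each of eight pieces (the signs of eta and zeta, and the sheet u = |eta| or
   u = 1 - |zeta|) as soon as four polynomial identities relate the parameters.
   They hold for (p,q,X,Z) = (8,10,5,Z) and (4,sqrt(9+Z^2),10,8).  As Z tends
   to 0 the first body, which is convex since X <= p, flattens, while the
   second, which is not convex since X > p, keeps a volume bounded below. *)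

(** * Coordinates of row vectors in dimension three *)

Lemma sum_ord3 (V : nmodType) (F : 'I_3 -> V) :
  \sum_(i < 3) F i = F 0 + F 1 + F 2.
Proof.
rewrite !big_ord_recl big_ord0 addr0 addrA.
by congr (F _ + F _ + F _); apply: val_inj.
Qed.

Lemma dotE (R : realType) (u v : 'rV[R]_3) :
  dot u v = u 0 0 * v 0 0 + u 0 1 * v 0 1 + u 0 2 * v 0 2.
Proof. by rewrite /dot sum_ord3. Qed.

Lemma row3P (R : pzRingType) (u v : 'rV[R]_3) :
  u 0 0 = v 0 0 -> u 0 1 = v 0 1 -> u 0 2 = v 0 2 -> u = v.
Proof.
move=> e0 e1 e2; apply/rowP => i.
have /or3P[] : [|| i == 0, i == 1 | i == 2] by case: i => -[|[|[|]]].
- by move=> /eqP->.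
- by move=> /eqP->.
- by move=> /eqP->.
Qed.

Lemma point3E (R : realType) (x y z : R) :
  (point3 (x, y, z) 0 0 = x) * (point3 (x, y, z) 0 1 = y) *
  (point3 (x, y, z) 0 2 = z).
Proof. by rewrite /point3 !mxE. Qed.

(** * Curve length, and maps that are isometric on finitely many closed pieces *)

Section length.
Variable R : realType.
Implicit Types (a b : R) (u v : R -> 'rV[R]_3) (s : seq R).

Lemma dot_ge0 (x : 'rV[R]_3) : 0 <= dot x x.
Proof. by rewrite dotE -!expr2 !addr_ge0 // sqr_ge0. Qed.

(** Lagrange's identity: the difference of the two sides is the sum of the squared two-by-two
    minors. *)
Lemma cauchy_schwarz (x y : 'rV[R]_3) : dot x y ^+ 2 <= dot x x * dot y y.
Proof.
rewrite !dotE -subr_ge0.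
set p := x 0 0; set q := x 0 1; set r := x 0 2.
set p' := y 0 0; set q' := y 0 1; set r' := y 0 2.
rewrite (_ : _ - _ = (p * q' - q * p') ^+ 2 + (p * r' - r * p') ^+ 2
  + (q * r' - r * q') ^+ 2); last by ring.
by rewrite !addr_ge0 // sqr_ge0.
Qed.

Lemma eucl_dist_triangle (y x z : 'rV[R]_3) :
  eucl_dist x z <= eucl_dist x y + eucl_dist y z.
Proof.
rewrite /eucl_dist; set A := dot (x - y) (x - y); set B := dot (y - z) (y - z).
have D : dot (x - z) (x - z) = A + B + 2 * dot (x - y) (y - z).
  by rewrite /A /B !dotE !mxE; ring.
have C : dot (x - y) (y - z) <= Num.sqrt A * Num.sqrt B.
  apply: le_trans (ler_norm _) _.
  by rewrite -sqrtrM ?dot_ge0 // -sqrtr_sqr ler_wsqrtr // cauchy_schwarz.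
have A0 : Num.sqrt A ^+ 2 = A by rewrite sqr_sqrtr // dot_ge0.
have B0 : Num.sqrt B ^+ 2 = B by rewrite sqr_sqrtr // dot_ge0.
rewrite -[leRHS]ger0_norm ?addr_ge0 ?sqrtr_ge0 // -sqrtr_sqr ler_wsqrtr // D.
by rewrite sqrrD A0 B0; lra.
Qed.

Lemma eucl_distxx (x : 'rV[R]_3) : eucl_dist x x = 0.
Proof. by rewrite /eucl_dist subrr dotE !mxE !mulr0 !addr0 sqrtr0. Qed.

(** The inscribed polygonal length of [curve_length], in a recursive form suited to induction on the
    partition. *)
Fixpoint path_length u a s : R :=
  if s is x :: s' then eucl_dist (u a) (u x) + path_length u x s' else 0.

Lemma sum_path_length u b a s :
  \sum_(0 <= k < size s) eucl_dist (u (nth b (a :: s) k)) (u (nth b s k))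
  = path_length u a s.
Proof.
elim: s a => [|x s ih] a /=; first by rewrite big_nil.
by rewrite big_nat_recl //= ih.
Qed.

Lemma path_length_cat u a s t :
  path_length u a (s ++ t) = path_length u a s + path_length u (last a s) t.
Proof. by elim: s a => [|x s ih] a /=; rewrite ?add0r // ih addrA. Qed.

Lemma eucl_dist_path_length u a s :
  eucl_dist (u a) (u (last a s)) <= path_length u a s.
Proof.
elim: s a => [|x s ih] a /=; first by rewrite eucl_distxx.
by apply: le_trans (eucl_dist_triangle (u x) _ _) _; rewrite lerD2l.
Qed.

(** Induction on the number of sets still in use. Some [T i] contains [a]; let [sup E] be the last
    time in [[a, b]] at which it occurs. From there on the other sets cover the interval, so
    induction gives a chain from [sup E] to [b], while [a] and [sup E] share [T i]. *)
Lemma finite_cover_chain (I : finType) (T : I -> set R) (A : {set I}) a b :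
  (forall i, closed (T i)) -> a < b ->
  (forall t, a <= t <= b -> exists2 i, i \in A & T i t) ->
  exists2 s, itv_partition a b s &
    path (fun x y => `[< exists i, T i x /\ T i y >]) a s.
Proof.
move=> cT; elim: {A}#|A| {-2}A (leqnn #|A|) a b => [|n ih] A An a b ab cov.
  have [|i iA _] := cov a; first by rewrite lexx ltW.
  by move: An; rewrite leqn0 => /eqP/cards0_eq A0; rewrite A0 inE in iA.
have [|i iA Ta] := cov a; first by rewrite lexx ltW.
pose E := T i `&` `[a, b].
have Ea : E a by split => //=; rewrite in_itv /= lexx ltW.
have ubE : ubound E b by move=> x [_ /=]; rewrite in_itv => /andP[].
have hsE : has_sup E by split; [exists a|exists b].
have Ec : closed E by apply: closedI => //; exact: itv_closed.
have [Tc /=] : E (sup E).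
  have : closure E (sup E) by apply: closure_sup; [exists a|exists b].
  by rewrite -((closure_id _).1 Ec).
rewrite in_itv /= => /andP[ac cb].
have relP x y j : T j x -> T j y -> `[< exists i, T i x /\ T i y >].
  by move=> ? ?; apply/asboolP; exists j.
have [cb'|bc] := ltP (sup E) b; last first.
  have cE : sup E = b by apply/eqP; rewrite eq_le cb.
  exists [:: b]; first by split => //=; rewrite ab.
  by rewrite /= (relP _ _ i) // -cE.
have covc t : sup E < t <= b -> exists2 j, j \in A :\ i & T j t.
  move=> /andP[ct tb]; have [|j jA Tj] := cov t.
    by rewrite tb (le_trans ac) // ltW.
  exists j => //; rewrite !inE jA andbT; apply/eqP => ji.
  move: (ct); rewrite ltNge => /negP; apply; apply: ub_le_sup; first by exists b.
  split; first by rewrite -ji.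
    by rewrite /= in_itv /= tb (le_trans ac) // ltW.
have cl : closed (\bigcup_(j in [set` A :\ i]) T j).
  by apply: closed_bigcup => [|j _]; [exact: finite_finset|exact: cT].
have [||s [ps /eqP ls] rs] := ih (A :\ i) _ (sup E) b cb'.
- by move: An; rewrite (cardsD1 i) iA add1n ltnS.
- move=> t /andP[]; rewrite le_eqVlt => /orP[/eqP <- _|ct tb]; last first.
    by apply: covc; rewrite ct.
  (* The remaining sets cover the points just to the right of [sup E]; their finite union is closed,
     so it also contains the limit [sup E]. *)
  have : (\bigcup_(j in [set` A :\ i]) T j) (sup E).
    apply: (closed_cvg _ cl (F := (sup E)^'+) (u_ := id)); last exact: cvg_at_right_filter.
    near=> r; have [|j jA Tj] := covc r; last by exists j.
    by apply/andP; split; near: r; [exact: nbhs_right_gt|exact: nbhs_right_le].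
  by case=> j /= jA Tj; exists j.
(* Partitions increase strictly, so [sup E] is inserted only if it differs from [a]. *)
move: ac; rewrite le_eqVlt => /orP[/eqP aE|ac].
  by exists s; rewrite aE //; split => //; rewrite ls.
exists (sup E :: s); first by split; rewrite /= ?ac ?ls.
by rewrite /= (relP _ _ i).
Unshelve. all: by end_near.
Qed.

Lemma path_length_eq (I : Type) (T : I -> set R) u v a s :
  (forall i x y, T i x -> T i y ->
    eucl_dist (u x) (u y) = eucl_dist (v x) (v y)) ->
  path (fun x y => `[< exists i, T i x /\ T i y >]) a s ->
  path_length u a s = path_length v a s.
Proof.
move=> uv; elim: s a => //= x s ih a /andP[/asboolP[i [Ta Tx]] /ih ->].
by rewrite (uv i).
Qed.

(** Each step of the partition is refined to a chain whose successive points share a piece. By the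
    triangle inequality refining can only lengthen the polygon of [u], and along the chain the
    distances for [u] and [v] agree. *)
Lemma itv_partition_refinement (I : finType) (T : I -> set R) u v a b s :
  (forall i, closed (T i)) ->
  (forall t, a <= t <= b -> exists i, T i t) ->
  (forall i x y, T i x -> T i y ->
    eucl_dist (u x) (u y) = eucl_dist (v x) (v y)) ->
  itv_partition a b s ->
  exists2 s', itv_partition a b s' & path_length u a s <= path_length v a s'.
Proof.
move=> cT; elim: s a => [|x s ih] a cov uv pas.
  by exists [::] => //=.
have pxs := itv_partition_cons pas.
have ax : a < x by case: pas => /= /andP[].
have xb := itv_partition_le pxs.
have [|s2 p2 l2] := ih x _ uv pxs.
  by move=> t /andP[xt tb]; apply: cov; rewrite tb (le_trans (ltW ax)).
have [|s1 p1 r1] := finite_cover_chain (A := [set: I]%SET) cT ax.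
  move=> t /andP[a_t tx]; have [|i Tt] := cov t; last by exists i.
  by rewrite a_t (le_trans tx).
exists (s1 ++ s2); first exact: itv_partition_cat p1 p2.
have l1 : last a s1 = x by case: p1 => _ /eqP.
rewrite /= path_length_cat l1 lerD // -(path_length_eq uv r1) -l1.
exact: eucl_dist_path_length.
Qed.

Lemma curve_length_le (I : finType) (T : I -> set R) u v a b :
  (forall i, closed (T i)) ->
  (forall t, a <= t <= b -> exists i, T i t) ->
  (forall i x y, T i x -> T i y ->
    eucl_dist (u x) (u y) = eucl_dist (v x) (v y)) ->
  (curve_length a b u <= curve_length a b v)%E.
Proof.
move=> cT cov uv; apply: ge_ereal_sup => _ [s ps <-].
rewrite sum_path_length.
have [s' ps' ls] := itv_partition_refinement cT cov uv ps.
apply: le_trans (_ : (path_length v a s')%:E <= _)%E; first by rewrite lee_fin.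
apply: ereal_sup_ubound; exists s' => //; congr EFin.
exact: sum_path_length.
Qed.

(** The pieces pulled back along the curve are closed sets of times covering [[a, b]]. The condition
    on them is symmetric in the curve and its image, so the comparison of lengths works in both
    directions. *)
Lemma piecewise_isometry_curve_length (I : finType) (C : I -> set 'rV[R]_3)
    (p : set 'rV[R]_3) (f : 'rV[R]_3 -> 'rV[R]_3) a b g :
  (forall i, closed (C i)) -> p `<=` \bigcup_i C i ->
  (forall i x y, C i x -> C i y -> eucl_dist (f x) (f y) = eucl_dist x y) ->
  curve_in p a b g -> curve_length a b (f \o g) = curve_length a b g.
Proof.
move=> cC pC fC [cg pg].
pose T i := `[a, b] `&` g @^-1` C i.
have cT i : closed (T i).
  have := cC i; move/continuous_closedP: cg => /[apply].
  by rewrite -closed_setSI //; exact: itv_closed.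
have cov t : a <= t <= b -> exists i, T i t.
  move=> atb; have [|i _ Ci] := pC (g t); first by apply: pg; rewrite in_itv /=.
  by exists i; split => //=; rewrite in_itv /=.
apply/eqP; rewrite eq_le; apply/andP; split.
  by apply: (curve_length_le cT cov) => i x y [_ ?] [_ ?]; exact: (fC i).
by apply: (curve_length_le cT cov) => i x y [_ ?] [_ ?]; rewrite /= (fC i).
Qed.
End length.

(** * The five vertices, their barycentric weights and the embedding of the faces *)

Lemma sum_bipyramid_vertex (V : nmodType) (F : bipyramid_vertex -> V) :
  \sum_k F k = F (inl true) + F (inl false)
    + (F (inr 0) + F (inr 1) + F (inr 2)).
Proof. by rewrite big_sumType /= big_bool sum_ord3. Qed.

Lemma bipyramid_vertexP (P : bipyramid_vertex -> Prop) :
  P (inl true) -> P (inl false) -> P (inr 0) -> P (inr 1) -> P (inr 2) ->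
  forall k, P k.
Proof.
move=> Pt Pf P0 P1 P2 [[]//|j].
have /or3P[] : [|| j == 0, j == 1 | j == 2] by case: j => -[|[|[|]]].
- by move=> /eqP->.
- by move=> /eqP->.
- by move=> /eqP->.
Qed.

Lemma bipyramid_faceP (A : {set bipyramid_vertex}) :
  reflect (exists s i, A = bipyramid_face s i) (A \in bipyramid_faces).
Proof.
apply: (iffP imsetP) => [[[s i] _ ->]|[s [i ->]]]; first by exists s, i.
by exists (s, i).
Qed.

Section vertices.
Variables (R : realType) (p q X Z : R).
Hypotheses (p_gt0 : 0 < p) (q_gt0 : 0 < q) (Z_gt0 : 0 < Z).

Definition bip_vertex (k : bipyramid_vertex) : 'rV[R]_3 :=
  point3 match k with
         | inl s => (X, 0, if s then Z else - Z)
         | inr j => if j == 0 then (0, 0, 0)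
                    else (p, if j == 1 then q else - q, 0)
         end.

Definition eta_coord (x : 'rV[R]_3) := x 0 1 / q.
Definition zeta_coord (x : 'rV[R]_3) := x 0 2 / Z.
Definition u_coord (x : 'rV[R]_3) := (x 0 0 - X * `|zeta_coord x|) / p.

(** Five points of 3-space admit many affine combinations equal to [x]. This is the one in which an
    apex weight vanishes: the apex weights are the positive and negative parts of zeta. *)
Definition bary (x : 'rV[R]_3) (k : bipyramid_vertex) : R :=
  match k with
  | inl s => (`|zeta_coord x| + (if s then 1 else -1) * zeta_coord x) / 2
  | inr j => if j == 0 then 1 - u_coord x - `|zeta_coord x|
             else (u_coord x + (if j == 1 then 1 else -1) * eta_coord x) / 2
  end.

Lemma sum_bip_vertex (w : bipyramid_vertex -> R) (i : 'I_3) :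
  (\sum_k w k *: bip_vertex k) 0 i =
  [:: p * (w (inr 1) + w (inr 2)) + X * (w (inl true) + w (inl false));
      q * (w (inr 1) - w (inr 2)); Z * (w (inl true) - w (inl false))]`_i.
Proof.
rewrite sum_bipyramid_vertex !mxE /=.
have /or3P[] : [|| i == 0, i == 1 | i == 2] by case: i => -[|[|[|]]].
- by move=> /eqP-> /=; ring.
- by move=> /eqP-> /=; ring.
- by move=> /eqP-> /=; ring.
Qed.

Lemma coordE (x : 'rV[R]_3) :
  (x 0 0 = p * u_coord x + X * `|zeta_coord x|) * (x 0 1 = q * eta_coord x)
  * (x 0 2 = Z * zeta_coord x).
Proof.
have [p0 q0 Z0] : [/\ p != 0, q != 0 & Z != 0] by rewrite !gt_eqF.
by split; [split|]; rewrite /u_coord /eta_coord /zeta_coord; field.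
Qed.

Lemma sum_bary x : \sum_k bary x k = 1.
Proof. by rewrite sum_bipyramid_vertex /=; field. Qed.

Lemma bary_combination x : x = \sum_k bary x k *: bip_vertex k.
Proof.
by apply: row3P; rewrite sum_bip_vertex coordE /=; field.
Qed.

(** With one apex weight zero and the other non-negative, zeta is the difference of the apex weights
    and its absolute value their sum, so the coordinates determine all weights. *)
Lemma bary_unique (w : bipyramid_vertex -> R) :
  0 <= w (inl true) -> 0 <= w (inl false) ->
  w (inl true) = 0 \/ w (inl false) = 0 -> \sum_k w k = 1 ->
  forall k, bary (\sum_k w k *: bip_vertex k) k = w k.
Proof.
move=> wt wf wtf; rewrite sum_bipyramid_vertex => w1.
set x := \sum_k _.
have [p0 q0 Z0] : [/\ p != 0, q != 0 & Z != 0] by rewrite !gt_eqF.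
have zE : zeta_coord x = w (inl true) - w (inl false).
  by rewrite /zeta_coord sum_bip_vertex /=; field.
have aE : `|zeta_coord x| = w (inl true) + w (inl false).
  rewrite zE; case: wtf => ->.
    by rewrite sub0r normrN ger0_norm // add0r.
  by rewrite subr0 ger0_norm // addr0.
have eE : eta_coord x = w (inr 1) - w (inr 2).
  by rewrite /eta_coord sum_bip_vertex /=; field.
have uE : u_coord x = w (inr 1) + w (inr 2).
  by rewrite /u_coord aE sum_bip_vertex /=; field.
by apply: bipyramid_vertexP; rewrite /bary ?aE ?zE ?uE ?eE /=; lra.
Qed.

(** Without one of the apexes the weights of a convex combination must be those of [bary].
    Intersecting hulls of faces then amounts to intersecting vertex sets. *)
Lemma hull_bary (A : {set bipyramid_vertex}) s : inl s \notin A ->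
  hull bip_vertex A =
  [set x | (forall k, 0 <= bary x k) /\ (forall k, k \notin A -> bary x k = 0)].
Proof.
move=> sA; apply/seteqP; split => x /=.
  case=> w [w0 w1 ->].
  pose w' k := if k \in A then w k else 0.
  have xE : \sum_(k in A) w k *: bip_vertex k = \sum_k w' k *: bip_vertex k.
    rewrite big_mkcond; apply: eq_bigr => k _; rewrite /w'.
    by case: ifP => // _; rewrite scale0r.
  have w'0 k : 0 <= w' k by rewrite /w'; case: ifP.
  have w's : w' (inl s) = 0 by rewrite /w' (negbTE sA).
  have E : forall k, bary (\sum_k w' k *: bip_vertex k) k = w' k.
    apply: bary_unique => //; last by rewrite -big_mkcond.
    by case: (s) w's => ?; [left|right].
  by rewrite xE; split=> k; rewrite E // /w' => /negbTE ->.
case=> b0 bA; exists (bary x); split=> //.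
  rewrite -[RHS](sum_bary x) [RHS](bigID (mem A)) /= [X in _ + X]big1 ?addr0 //.
rewrite [LHS]bary_combination (bigID (mem A)) /= [X in _ + X]big1 ?addr0 //.
by move=> k /bA ->; rewrite scale0r.
Qed.

(** The affine dependences among the five vertices form a line, spanned by the weights 1 at the
    apexes, [- (X / p)] at base vertices 1 and 2, and [- 2 * (1 - X / p)] at base vertex 0. None of
    these is zero, so a dependence that vanishes at [k0] vanishes everywhere. *)
Lemma affinely_independent_bip (A : {set bipyramid_vertex}) k0 :
  X != 0 -> X != p -> k0 \notin A -> affinely_independent bip_vertex A.
Proof.
move=> X0 Xp k0A w w1 wv.
pose w' k := if k \in A then w k else 0.
suff w'0 : forall k, w' k = 0.
  by move=> k kA; have := w'0 k; rewrite /w' kA.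
have wk0 : w' k0 = 0 by rewrite /w' (negbTE k0A).
have {}w1 : \sum_k w' k = 0 by rewrite -big_mkcond.
have {}wv i : (\sum_k w' k *: bip_vertex k) 0 i = 0.
  rewrite (_ : \sum_k _ = 0) ?mxE // -[RHS]wv [RHS]big_mkcond.
  apply: eq_bigr => k _; rewrite /w'.
  by case: ifP => // _; rewrite scale0r.
have := wv 0; have := wv 1; have := wv 2; rewrite !sum_bip_vertex /=.
move=> /eqP; rewrite mulf_eq0 gt_eqF //= subr_eq0 => /eqP wt.
move=> /eqP; rewrite mulf_eq0 gt_eqF //= subr_eq0 => /eqP w12.
move=> e; rewrite sum_bipyramid_vertex in w1.
have w2 : w' (inr 2) = - (X / p) * w' (inl false).
  have p0 : p != 0 by rewrite gt_eqF.
  apply: (mulfI p0).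
  have -> : p * (- (X / p) * w' (inl false)) = - (X * w' (inl false)).
    by field.
  by move: e; rewrite wt w12; lra.
have w0 : w' (inr 0) = - 2 * (1 - X / p) * w' (inl false).
  by move: w1; rewrite wt w12 w2; lra.
suff wf0 : w' (inl false) = 0.
  by apply: bipyramid_vertexP; rewrite ?wt ?w12 ?w0 ?w2 ?wf0 ?mulr0.
have Xp0 : 1 - X / p != 0.
  by rewrite subr_eq0 eq_sym; apply: contra Xp => /eqP h; apply/eqP; rewrite -[RHS]mul1r -h divfK // gt_eqF.
have Xdp0 : X / p != 0 by rewrite mulf_neq0 // invr_neq0 // gt_eqF.
move: k0 wk0 {k0A}; apply: bipyramid_vertexP; rewrite ?wt ?w12 ?w0 ?w2 // => /eqP.
- by rewrite !mulf_eq0 (negbTE Xp0) oppr_eq0 pnatr_eq0 => /eqP.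
- by rewrite !mulf_eq0 oppr_eq0 (negbTE Xdp0) => /eqP.
- by rewrite !mulf_eq0 oppr_eq0 (negbTE Xdp0) => /eqP.
Qed.

Lemma bip_realizes : X != 0 -> X != p -> realizes bipyramid_faces bip_vertex.
Proof.
move=> X0 Xp; split.
- move=> A /bipyramid_faceP[s [i ->]].
  by apply: (@affinely_independent_bip _ (inl (~~ s))) => //; rewrite inE; case: s.
- move=> A B /bipyramid_faceP[s [i ->]] /bipyramid_faceP[t [j ->]].
  rewrite (@hull_bary _ (~~ s)); last by rewrite inE; case: s.
  rewrite (@hull_bary _ (~~ t)); last by rewrite inE; case: t.
  rewrite (@hull_bary _ (~~ s)); last by rewrite !inE; case: s.
  apply/seteqP; split => x /=.
    by move=> [[b0 bA] [_ bB]]; split=> // k; rewrite finset.in_setI negb_and => /orP[/bA|/bB].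
  by case=> b0 bAB; split; split => // k kn; apply: bAB; rewrite finset.in_setI negb_and kn ?orbT.
- move=> A B /bipyramid_faceP[s [i ->]] /bipyramid_faceP[t [j ->]] c2.
  (* Faces with a common side share the apex or the base side, and then their union misses a vertex.
     Otherwise they have at most one common vertex, against [c2]. *)
  have [st|st] := eqVneq s t.
    apply: (@affinely_independent_bip _ (inl (~~ s))) => //.
    by rewrite !inE -st; case: s {st c2}.
  have [ij|ij] := eqVneq i j.
    by apply: (@affinely_independent_bip _ (inr i)) => //; rewrite !inE -ij eqxx.
  suff : (#|bipyramid_face s i :&: bipyramid_face t j| <= 1)%N by rewrite c2.
  have sub : bipyramid_face s i :&: bipyramid_face t j
             \subset inr @: ~: [set i; j].
    apply/fintype.subsetP => -[r|k]; rewrite !inE.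
      by move=> /andP[/eqP-> st']; rewrite st' in st.
    by rewrite -negb_or => kij; rewrite imset_f // !inE.
  apply: leq_trans (subset_leq_card sub) _.
  by rewrite card_imset; [rewrite cardsCs finset.setCK cards2 ij card_ord|move=> ? ? []].
Qed.
End vertices.

(** * Connectedness and the region enclosed by the surface *)

Lemma connected_sub_open (T : topologicalType) (C O F : set T) :
  connected C -> open O -> closed F -> O `<=` F -> C `&` F `<=` O ->
  C `&` O !=set0 -> C `<=` O.
Proof.
move=> cC oO cF OF CFO CO0.
(* The part of [C] in [O] is open in [C], and closed in [C] because it is also the part in [F]. *)
rewrite -(cC (C `&` O) CO0); first by move=> x [].
- by exists O.
- exists F => //; apply/seteqP; split => x [Cx]; first by move=> /OF.
  by move=> Fx; split => //; apply: CFO.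
Qed.

Lemma line_continuous (R : realType) (x e : 'rV[R]_3) :
  continuous (fun t : R => x + t *: e).
Proof. by move=> t; apply: cvgD; [exact: cvg_cst|apply: cvgZr_tmp; exact: cvg_id]. Qed.

Lemma line_image_connected (R : realType) (x e : 'rV[R]_3) (I : interval R) :
  connected ((fun t : R => x + t *: e) @` [set` I]).
Proof.
apply: connected_continuous_connected.
  by apply/connected_intervalP; exact: interval_is_interval.
by apply: continuous_subspaceT; exact: line_continuous.
Qed.

Lemma le_coord_norm (R : realType) (x : 'rV[R]_3) i : `|x 0 i| <= `|x|.
Proof.
rewrite [leRHS]/Num.Def.normr /= mx_normrE.
by apply/bigmax_geP; right => /=; exists (0, i).
Qed.

Lemma coord_le_norm (R : realType) (x : 'rV[R]_3) M :
  0 <= M -> (forall i, `|x 0 i| <= M) -> `|x| <= M.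
Proof.
move=> M0 xM; rewrite [leLHS]/Num.Def.normr /= mx_normrE.
by apply: bigmax_le => //= -[i j] _ /=; rewrite ord1.
Qed.

Lemma coord3_continuous (R : realType) (i : 'I_3) :
  continuous (fun x : 'rV[R]_3 => x 0 i).
Proof. exact: coord_continuous. Qed.

Section solid.
Variables (R : realType) (p q X Z : R).
Hypotheses (p_gt0 : 0 < p) (q_gt0 : 0 < q) (Z_gt0 : 0 < Z).
Local Notation eta := (@eta_coord R q).
Local Notation zeta := (@zeta_coord R Z).
Local Notation u := (@u_coord R p X Z).

(** The gaps are signed distances along the first axis, in the scale of u, to the lower sheet u =
    |eta| and the upper sheet u = 1 - |zeta|. *)
Definition low_gap (x : 'rV[R]_3) := u x - `|eta x|.
Definition high_gap (x : 'rV[R]_3) := 1 - `|zeta x| - u x.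

Definition solid := [set x | 0 <= low_gap x /\ 0 <= high_gap x].
Definition open_solid := [set x | 0 < low_gap x /\ 0 < high_gap x].

Lemma eta_continuous : continuous eta.
Proof.
by move=> x; apply: (continuousM (@coord3_continuous R 1 x)); exact: cst_continuous.
Qed.

Lemma zeta_continuous : continuous zeta.
Proof.
by move=> x; apply: (continuousM (@coord3_continuous R 2 x)); exact: cst_continuous.
Qed.

Lemma abs_continuous (f : 'rV[R]_3 -> R) :
  continuous f -> continuous (fun x => `|f x|).
Proof.
by move=> cf x; apply: (continuous_comp (cf x)); exact: norm_continuous.
Qed.

Lemma u_continuous : continuous u.
Proof.
have num_cont : continuous (fun x : 'rV[R]_3 => x 0 0 - X * `|zeta x|).
  move=> x; apply: (continuousB (@coord3_continuous R 0 x)).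
  apply: (continuousM (@cst_continuous _ _ X x)).
  exact: (abs_continuous zeta_continuous).
by move=> x; apply: (continuousM (num_cont x)); exact: cst_continuous.
Qed.

Lemma low_gap_continuous : continuous low_gap.
Proof.
move=> x; apply: (continuousB (u_continuous (x := x))).
exact: (abs_continuous eta_continuous).
Qed.

Lemma high_gap_continuous : continuous high_gap.
Proof.
have one_cont : continuous (fun x : 'rV[R]_3 => 1 - `|zeta x|).
  move=> x; apply: (continuousB (@cst_continuous _ _ (1 : R) x)).
  exact: (abs_continuous zeta_continuous).
by move=> x; apply: (continuousB (one_cont x)); exact: u_continuous.
Qed.

Lemma solid_closed : closed solid.
Proof.
rewrite (_ : solid = low_gap @^-1` [set t | 0 <= t]
                     `&` high_gap @^-1` [set t | 0 <= t]) //.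
apply: closedI; apply: closed_comp; try exact: closed_ge.
- by move=> ? _; exact: low_gap_continuous.
- by move=> ? _; exact: high_gap_continuous.
Qed.

Lemma open_solid_open : open open_solid.
Proof.
rewrite (_ : open_solid = low_gap @^-1` [set t | 0 < t]
                     `&` high_gap @^-1` [set t | 0 < t]) //.
apply: openI; apply: open_comp; try exact: open_gt.
- by move=> ? _; exact: low_gap_continuous.
- by move=> ? _; exact: high_gap_continuous.
Qed.

Lemma open_solid_sub : open_solid `<=` solid.
Proof. by move=> x [l h]; split; exact: ltW. Qed.

Lemma open_solid_bounds x : open_solid x ->
  [/\ 0 < u x < 1, `|eta x| < 1 & `|zeta x| < 1].
Proof.
rewrite /open_solid /low_gap /high_gap /= => -[l h].
have := normr_ge0 (eta x); have := normr_ge0 (zeta x) => *.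
by split; [apply/andP; split|idtac..]; lra.
Qed.

Lemma open_solid_bounded : bounded_set open_solid.
Proof.
pose B := p + `|X| + q + Z.
have [bX bq bZ] : [/\ p + `|X| <= B, q <= B & Z <= B].
  by move: p_gt0 q_gt0 Z_gt0 (normr_ge0 X) => ? ? ? ?; rewrite /B; split; lra.
exists B; split; first by rewrite num_real.
move=> M /ltW bM x Sx /=; apply: le_trans bM.
have [/andP[u0 u1] e1 z1] := open_solid_bounds Sx.
have [[x0 x1] x2] := coordE X p_gt0 q_gt0 Z_gt0 x.
move: (u x) (eta x) (zeta x) => U E F in u0 u1 e1 z1 x0 x1 x2 *.
apply: coord_le_norm => [|i]; first exact: le_trans (ltW q_gt0) bq.
have /or3P[] : [|| i == 0, i == 1 | i == 2] by case: i => -[|[|[|]]].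
- move=> /eqP->; rewrite x0; apply: le_trans bX; apply: le_trans (ler_normD _ _) _.
  by rewrite !normrM normr_id (gtr0_norm p_gt0) (gtr0_norm u0) lerD // ler_piMr // ltW.
- move=> /eqP->; rewrite x1 normrM (gtr0_norm q_gt0); apply: le_trans bq.
  by rewrite ler_piMr // ltW.
- move=> /eqP->; rewrite x2 normrM (gtr0_norm Z_gt0); apply: le_trans bZ.
  by rewrite ler_piMr // ltW.
Qed.

(** The first axis is the direction in which points are pushed out of the solid, both to reach
    infinity and to find its interior. *)
Lemma gap_shift (x : 'rV[R]_3) t :
  (low_gap (x + t *: delta_mx 0 0) = low_gap x + t / p) *
  (high_gap (x + t *: delta_mx 0 0) = high_gap x - t / p).
Proof.
have e : eta (x + t *: delta_mx 0 0) = eta x.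
  by rewrite /eta_coord !mxE /= mulr0 addr0.
have z : zeta (x + t *: delta_mx 0 0) = zeta x.
  by rewrite /zeta_coord !mxE /= mulr0 addr0.
have uE : u (x + t *: delta_mx 0 0) = u x + t / p.
  rewrite /u_coord z !mxE /= mulr1.
  by field; rewrite gt_eqF.
by rewrite /low_gap /high_gap e z uE; split; ring.
Qed.

Lemma ray_unbounded (x : 'rV[R]_3) (s : R) : `|s| = 1 ->
  ~ bounded_set ((fun t : R => x + t *: (s *: delta_mx 0 0)) @` `[0, +oo[).
Proof.
move=> s1 [M [_ bM]].
have := bM (`|M| + 1); rewrite (le_lt_trans (ler_norm M)) ?ltrDl //.
move=> /(_ isT).
(* At this parameter the first coordinate is at least [|M| + 2] in absolute value, beyond the
   supposed bound [|M| + 1]. *)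
pose t := `|x 0 0| + `|M| + 2.
have t0 : 0 <= t by rewrite /t; have := normr_ge0 (x 0 0); have := normr_ge0 M; lra.
move=> /(_ (x + t *: (s *: delta_mx 0 0))) /=.
have -> : (exists2 x0 : R, x0 \in `[0, +oo[ &
   x + x0 *: (s *: delta_mx 0 0) = x + t *: (s *: delta_mx 0 0)) = True.
  by apply/propext; split=> // _; exists t => //; rewrite in_itv /= t0.
move=> /(_ I) /(le_trans (le_coord_norm _ 0)).
rewrite !mxE /= mulr1 => h.
have := ler_normB (x 0 0 + t * s) (x 0 0).
rewrite addrAC subrr add0r normrM s1 mulr1 (ger0_norm t0).
by rewrite /t; lra.
Qed.

(** Off the surface a point is outside the solid or in the open solid. In the first case its
    component contains a ray; in the second its component stays in the open solid, which is
    bounded. *)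
Lemma enclosed_solid : enclosed (solid `\` open_solid) = open_solid.
Proof.
have nS x : (~` (solid `\` open_solid)) x <-> (~ solid x \/ open_solid x).
  rewrite /setC /setD /=; split => [/not_andP[|/contrapT]|[h [//]|h [_ //]]].
    by left.
  by right.
apply/seteqP; split => x.
  move=> [/nS[nx|//] bx]; exfalso.
  (* Go backwards if the low gap is negative and forwards if the high gap is: the negative gap never
     increases along the ray. *)
  have [s s1 sx] : exists2 s : R, `|s| = 1 &
      forall t, 0 <= t -> ~ solid (x + t *: (s *: delta_mx 0 0)).
    have [l|l] := ltP (low_gap x) 0; last have [h|h] := ltP (high_gap x) 0.
    - exists (-1) => [|t t0 []]; first by rewrite normrN1.
      rewrite scalerA mulrN1 gap_shift mulNr.
      have : 0 <= t / p by rewrite divr_ge0 // ltW.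
      by lra.
    - exists 1 => [|t t0 [_]]; first by rewrite normr1.
      rewrite scalerA mulr1 gap_shift.
      have : 0 <= t / p by rewrite divr_ge0 // ltW.
      by lra.
    - by case: nx.
  apply: (ray_unbounded (x := x) s1); case: bx => M [Mr bM].
  exists M; split=> // N MN y yr; apply: (bM N MN).
  apply: connected_component_max yr; last exact: line_image_connected.
  - by exists 0; rewrite ?scale0r ?addr0 //= in_itv /= lexx.
  - move=> z [t + <-]; rewrite /= in_itv /= andbT => t0.
    by apply/nS; left; exact: sx.
move=> ox; split; first by apply/nS; right.
case: open_solid_bounded => M [Mr bM].
exists M; split=> // N MN y yr; apply: (bM N MN); move: y yr.
have xx : (~` (solid `\` open_solid)) x by apply/nS; right.
apply: (connected_sub_open (F := solid)).
- exact: component_connected.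
- exact: open_solid_open.
- exact: solid_closed.
- exact: open_solid_sub.
- by move=> y [/connected_component_sub /nS[]].
- by exists x; split => //; exact: connected_component_refl.
Qed.
End solid.

(** * Midpoints in convex sets, the surface as frontier of the solid, and the convex case
    [X <= p] *)

Lemma convex_midpoint (R : realType) (K : set 'rV[R]_3) (x y : 'rV[R]_3) :
  convex_set K -> K x -> K y -> K (2^-1 *: (x + y)).
Proof.
have h0 : (0 : R) <= 2^-1 by rewrite invr_ge0.
have h1 : (2^-1 : R) <= 1 by rewrite invf_le1 // ler1n.
move=> cK Kx Ky; have := cK x y (Itv01 h0 h1) (mem_set Kx) (mem_set Ky).
move=> /set_mem; rewrite scalerDr /conv /=.
have e : 1 - 2^-1 = 2^-1 :> R by field.
by rewrite /= /unstable.onem e.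
Qed.

Lemma closure_normP (R : realType) (K : set 'rV[R]_3) (x : 'rV[R]_3) e :
  closure K x -> 0 < e -> exists2 y, K y & `|x - y| < e.
Proof.
move=> cK e0; have [|y [Ky xy]] := cK (ball x e); first exact: nbhsx_ballx.
by exists y => //; move: xy; rewrite -ball_normE.
Qed.

(** The set [K] of [convex_surface] may fail to be closed, so points of the surface are only known
    to lie in its closure. *)
Lemma convex_closure_midpoint (R : realType) (K : set 'rV[R]_3) (x y : 'rV[R]_3) :
  convex_set K -> closure K x -> closure K y -> closure K (2^-1 *: (x + y)).
Proof.
move=> cK Kx Ky B /nbhs_ballP[e /= e0 eB].
have [x' Kx' xx'] := closure_normP Kx e0.
have [y' Ky' yy'] := closure_normP Ky e0.
exists (2^-1 *: (x' + y')); split; first exact: convex_midpoint.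
apply: eB; rewrite -ball_normE /= -scalerBr opprD addrACA normrZ.
rewrite ger0_norm ?invr_ge0 //.
have : `|x - x' + (y - y')| < e + e.
  by apply: le_lt_trans (ler_normD _ _) _; exact: ltrD.
rewrite ltr_pdivrMl // mulr_natl mulr2n; exact.
Qed.

Section convexity.
Variables (R : realType) (p q X Z : R).
Hypotheses (p_gt0 : 0 < p) (q_gt0 : 0 < q) (Z_gt0 : 0 < Z).
Local Notation eta := (@eta_coord R q).
Local Notation zeta := (@zeta_coord R Z).
Local Notation u := (@u_coord R p X Z).
Local Notation low := (@low_gap R p q X Z).
Local Notation high := (@high_gap R p X Z).
Local Notation body := (@solid R p q X Z).
Local Notation open_body := (@open_solid R p q X Z).

(** The weight of base vertex 0 is the high gap, and the smaller of the other two base weights is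
    half the low gap. Hence some base weight vanishes exactly when the point of the solid is on a
    sheet; an apex weight always vanishes. *)
Lemma union_hull_faces :
  \bigcup_(A in [set A | A \in bipyramid_faces]) hull (bip_vertex p q X Z) A
  = body `\` open_body.
Proof.
apply/seteqP; split => x.
  case=> A /= /bipyramid_faceP[s [i ->]].
  rewrite (@hull_bary _ _ _ _ _ p_gt0 q_gt0 Z_gt0 _ (~~ s)); last by rewrite inE; case: (s).
  case=> b0 /(_ (inr i)); rewrite inE eqxx => /(_ isT) bi.
  have := b0 (inr 0); have := b0 (inr 1); have := b0 (inr 2).
  rewrite /= => b2 b1 bh.
  have lowge : 0 <= low x by rewrite /low_gap; case: ler0P => _; lra.
  split; first by split => //; rewrite /high_gap; lra.
  rewrite /open_solid /low_gap /high_gap /= => -[l h]; move: bi b0.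
  move: (ler_norm (eta x)) (lerNnormlW (lexx `|eta x|)).
  by have /or3P[] : [|| i == 0, i == 1 | i == 2] by [case: i => -[|[|[|]]]];
    move=> /eqP-> /=; lra.
case=> -[]; rewrite /low_gap /high_gap => l h nox.
have [i xi] : exists i, bary p q X Z x (inr i) = 0.
  have [hh|hh] := ltP 0 (high x); last first.
    by exists 0; move: hh; rewrite /high_gap /=; lra.
  have [ll|ll] := ltP 0 (low x); first by case: nox.
  move: ll; rewrite /low_gap.
  by case: (ger0P (eta x)) l => ? ? ?; [exists 2|exists 1] => /=; lra.
have [s xs] : exists s, bary p q X Z x (inl (~~ s)) = 0.
  by case: (ger0P (zeta x)) => z0; [exists true|exists false];
    rewrite /= ?(ger0_norm z0) ?(ltr0_norm z0); lra.
exists (bipyramid_face s i); first by apply/bipyramid_faceP; exists s, i.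
rewrite (@hull_bary _ _ _ _ _ p_gt0 q_gt0 Z_gt0 _ (~~ s)); last by rewrite inE; case: (s).
split.
  have := ler_norm (eta x); have := lerNnormlW (lexx `|eta x|).
  have := ler_norm (zeta x); have := lerNnormlW (lexx `|zeta x|).
  by move=> ? ? ? ?; apply: bipyramid_vertexP => /=; lra.
case=> [t|j]; rewrite inE; last by rewrite negbK => /eqP->.
by move=> ts; rewrite -[RHS]xs; congr bary; congr inl; case: t s ts {xs} => -[].
Qed.

Lemma solid_interior : body° = open_body.
Proof.
apply/seteqP; split => x; last first.
  move=> ox; apply: (filterS (@open_solid_sub R p q X Z)).
  by apply: open_nbhs_nbhs; split => //; exact: open_solid_open.
move=> ix; have [l h] := interior_subset ix.
(* An interior point can move both ways along the first axis inside the solid, which forces both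
   gaps to be positive. *)
have : nbhs (x + (0 : R) *: delta_mx 0 0) body by rewrite scale0r addr0.
move=> /(@line_continuous R x (delta_mx 0 0) 0) /nbhs_ballP[e /= e0 eS].
have t0 : 0 < e / 2 / p by rewrite !divr_gt0.
have b1 : ball 0 e (e / 2).
  by rewrite /ball /= sub0r normrN gtr0_norm ?divr_gt0 //; lra.
have b2 : ball 0 e (- (e / 2)).
  by rewrite /ball /= sub0r opprK gtr0_norm ?divr_gt0 //; lra.
have [_] := eS _ b1; rewrite gap_shift // => h'.
have [+ _] := eS _ b2; rewrite gap_shift // mulNr => l'.
by split; lra.
Qed.

(** With [k = X / p] the gaps are [x 0 0 / p - k * |zeta| - |eta|] and
    [1 - (1 - k) * |zeta| - x 0 0 / p]. Both are concave since k and 1 - k are non-negative. *)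
Lemma solid_convex : 0 <= X -> X <= p -> convex_set body.
Proof.
move=> X0 Xp x y t /set_mem[lx hx] /set_mem[ly hy]; apply/mem_set.
have [t0 t1] : 0 <= t%:num /\ t%:num <= 1 by split.
have -> : conv t x y = t%:num *: x + (1 - t%:num) *: y by [].
set z := _ *: x + _ *: y.
have zE i : z 0 i = t%:num * x 0 i + (1 - t%:num) * y 0 i by rewrite !mxE.
move: z zE; move: (t%:num) t0 t1 => {}t t0 t1 z zE.
have t10 : 0 <= 1 - t by rewrite subr_ge0.
have eE : eta z = t * eta x + (1 - t) * eta y.
  by rewrite /eta_coord zE; field; rewrite gt_eqF.
have fE : zeta z = t * zeta x + (1 - t) * zeta y.
  by rewrite /zeta_coord zE; field; rewrite gt_eqF.
have eL : `|eta z| <= t * `|eta x| + (1 - t) * `|eta y|.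
  by rewrite eE (le_trans (ler_normD _ _)) // !normrM (ger0_norm t0) (ger0_norm t10).
have fL : `|zeta z| <= t * `|zeta x| + (1 - t) * `|zeta y|.
  by rewrite fE (le_trans (ler_normD _ _)) // !normrM (ger0_norm t0) (ger0_norm t10).
pose k := X / p.
have k0 : 0 <= k by rewrite divr_ge0 // ltW.
have k1 : 0 <= 1 - k by rewrite subr_ge0 ler_pdivrMr // mul1r.
have uE w : u w = w 0 0 / p - k * `|zeta w|.
  by rewrite /u_coord /k; field; rewrite gt_eqF.
have z0 : z 0 0 / p = t * (x 0 0 / p) + (1 - t) * (y 0 0 / p).
  by rewrite zE; field; rewrite gt_eqF.
have := mulr_ge0 t0 lx; have := mulr_ge0 t10 ly.
have := mulr_ge0 t0 hx; have := mulr_ge0 t10 hy.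
have := ler_wpM2l k0 fL; have := ler_wpM2l k1 fL.
rewrite /solid /low_gap /high_gap /= !uE z0.
set a := `|zeta z|; set b := `|zeta x|; set c := `|zeta y|.
move=> *; split; lra.
Qed.

Lemma convex_solid_surface : 0 <= X -> X <= p ->
  convex_surface (body `\` open_body).
Proof.
move=> X0 Xp; exists body; split; first exact: solid_convex.
by rewrite solid_interior -((closure_id _).1 (@solid_closed R p q X Z)).
Qed.
End convexity.

(** * Nonconvexity when [p < X] *)

Lemma interior_segment (R : realType) (K : set 'rV[R]_3) (x e : 'rV[R]_3) :
  (forall t, 0 <= t <= 1 -> ~ (closure K `\` K°) (x + t *: e)) ->
  K° x -> K° (x + e).
Proof.
move=> avoid Kx.
(* The segment is connected and meets the closure of [K] only in the interior of [K]. *)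
have sub : (fun t : R => x + t *: e) @` `[0, 1] `<=` K°.
  apply: (connected_sub_open (F := closure K)).
  - exact: line_image_connected.
  - exact: open_interior.
  - exact: closed_closure.
  - by move=> y /interior_subset; exact: subset_closure.
  - move=> y [[t + <-] cy]; rewrite /= in_itv /= => t01.
    by apply: contrapT => ny; apply: (avoid t t01).
  - exists x; split => //; exists 0; last by rewrite scale0r addr0.
    by rewrite /= in_itv /= lexx ler01.
by apply: sub; exists 1; rewrite ?scale1r //= in_itv /= lexx ler01.
Qed.

Lemma row_addE (R : pzRingType) n (x y : 'rV[R]_n) i :
  (x + y) 0 i = x 0 i + y 0 i.
Proof. by rewrite mxE. Qed.

Lemma row_scaleE (R : pzRingType) n (t : R) (x : 'rV[R]_n) i :
  (t *: x) 0 i = t * x 0 i.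
Proof. by rewrite mxE. Qed.

Section nonconvexity.
Variables (R : realType) (p q X Z : R).
Hypotheses (p_gt0 : 0 < p) (q_gt0 : 0 < q) (Z_gt0 : 0 < Z).
Local Notation body := (@solid R p q X Z).
Local Notation open_body := (@open_solid R p q X Z).
Local Notation eta := (@eta_coord R q).
Local Notation zeta := (@zeta_coord R Z).
Local Notation u := (@u_coord R p X Z).

Lemma solid_bounds x : body x -> `|eta x| <= 1 /\ u x <= 1.
Proof.
rewrite /solid /low_gap /high_gap /= => -[l h].
by have := normr_ge0 (eta x); have := normr_ge0 (zeta x); split; lra.
Qed.

(** The midpoint [a] of the apexes is outside the solid, yet in the closure of any admissible [K],
    hence in its interior. From [a], segments that avoid the surface spread this to all points with
    |eta| > 1. Every point is a midpoint of two of those, so [K] is the whole space and has no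
    frontier. *)
Lemma nonconvex_solid_surface : p < X -> ~ convex_surface (body `\` open_body).
Proof.
move=> pX [K [cK SE]].
have [p0 q0 Z0] : [/\ p != 0, q != 0 & Z != 0] by rewrite !gt_eqF.
have clos x : body x -> ~ open_body x -> closure K x.
  by move=> bx nx; have : (body `\` open_body) x by []; rewrite SE => -[].
have intr x : closure K x -> ~ body x -> K° x.
  move=> cx nx; apply: contrapT => nKx.
  by have : (closure K `\` K°) x by []; rewrite -SE => -[].
have avoid x : ~ body x -> ~ (closure K `\` K°) x by rewrite -SE => nx [].
pose a := point3 (X, 0, 0).
have apexes s : s = 1 \/ s = -1 -> closure K (point3 (X, 0, s * Z)).
  move=> s1; set b := point3 _.
  have zE : `|zeta b| = 1.
    by rewrite /zeta_coord point3E mulfK //; case: s1 => ->; rewrite ?normrN normr1.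
  have eE : eta b = 0 by rewrite /eta_coord point3E mul0r.
  have uE : u b = 0 by rewrite /u_coord zE point3E mulr1 subrr mul0r.
  apply: clos; rewrite /solid /open_solid /low_gap /high_gap /= eE uE zE normr0 !subrr.
    by split.
  by case; rewrite ltxx.
have aK : K° a.
  apply: intr; last first.
    move=> /solid_bounds[_]; rewrite /u_coord /zeta_coord !point3E.
    by rewrite mul0r normr0 mulr0 subr0 ler_pdivrMr // mul1r leNgt pX.
  have -> : a = 2^-1 *: (point3 (X, 0, 1 * Z) + point3 (X, 0, -1 * Z)).
    by apply: row3P; rewrite row_scaleE row_addE !point3E; field.
  by apply: convex_closure_midpoint => //; apply: apexes; [left|right].
(* Two segments lead from [a] to [x]: the first keeps u = X / p > 1, the second keeps |eta| > 1, and
   neither meets the solid. *)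
have far x : 1 < `|eta x| -> K° x.
  move=> ex.
  have yK : K° (a + point3 (0, x 0 1, 0)).
    apply: interior_segment aK => t _; apply: avoid => /solid_bounds[_].
    rewrite /u_coord /zeta_coord !row_addE !row_scaleE !point3E !mulr0 !addr0.
    by rewrite mul0r normr0 mulr0 subr0 ler_pdivrMr // mul1r leNgt pX.
  have -> : x = a + point3 (0, x 0 1, 0) + point3 (x 0 0 - X, 0, x 0 2).
    by apply: row3P; rewrite !row_addE !point3E; ring.
  apply: interior_segment yK => t _; apply: avoid => /solid_bounds[+ _].
  rewrite /eta_coord !row_addE row_scaleE !point3E.
  by rewrite mulr0 addr0 add0r leNgt ex.
have all_K x : K x.
  (* The shift makes |eta| at least 2 at both [x + d] and [x - d]. *)
  pose d := point3 (0, (2 + `|eta x|) * q, 0).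
  have dE s : eta (x + s *: d) = eta x + s * (2 + `|eta x|).
    by rewrite /eta_coord row_addE row_scaleE !point3E; field.
  have -> : x = 2^-1 *: ((x + 1 *: d) + (x + (-1) *: d)).
    by apply: row3P; rewrite !(row_scaleE, row_addE); field.
  have := ler_norm (eta x); have := lerNnormlW (lexx `|eta x|) => l1 l2.
  apply: convex_midpoint => //; apply: interior_subset; apply: far; rewrite dE.
    by apply: lt_le_trans (ler_norm _); lra.
  by rewrite -normrN; apply: lt_le_trans (ler_norm _); lra.
have : (body `\` open_body) 0.
  have e0 : eta 0 = 0 by rewrite /eta_coord mxE mul0r.
  have z0 : zeta 0 = 0 by rewrite /zeta_coord mxE mul0r.
  have u0 : u 0 = 0 by rewrite /u_coord z0 mxE normr0 mulr0 subr0 mul0r.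
  rewrite /setD /solid /open_solid /low_gap /high_gap /= e0 u0 z0 normr0 !subr0.
  by split; [split|case; rewrite ltxx].
rewrite SE => -[_]; apply; rewrite (_ : K = setT) ?interiorT //.
by apply/seteqP; split.
Qed.
End nonconvexity.

(** * The exchange map and its isometry *)

Lemma row_subE (R : pzRingType) n (x y : 'rV[R]_n) i :
  (x - y) 0 i = x 0 i - y 0 i.
Proof. by rewrite !mxE. Qed.

Lemma row3_continuous (R : realType) (T : topologicalType) (f : T -> 'rV[R]_3) :
  (forall i, continuous (fun x => f x 0 i)) -> continuous f.
Proof.
move=> cf x A [P Px PA].
apply: (filterS (P := fun y => forall j, P 0 j (f y 0 j))).
  by move=> y Py; apply: PA => i j; rewrite ord1.
by apply: filter_forall => j; exact: cf (Px 0 j).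
Qed.

Section exchange.
Variables (R : realType) (p q X Z p' q' X' Z' : R).

(** These are the formulas of [coordE] for the target parameters, taken at the exchanged
    coordinates. *)
Definition exchange (x : 'rV[R]_3) : 'rV[R]_3 :=
  let eta := eta_coord q x in
  let zeta := zeta_coord Z x in
  let u := u_coord p X Z x in
  point3 (p' * (u + `|zeta| - `|eta|) + X' * `|eta|, q' * zeta, Z' * eta).

Hypotheses (p'_gt0 : 0 < p') (q'_gt0 : 0 < q') (Z'_gt0 : 0 < Z').

Lemma exchange_coords x :
  [/\ eta_coord q' (exchange x) = zeta_coord Z x,
      zeta_coord Z' (exchange x) = eta_coord q x &
      u_coord p' X' Z' (exchange x)
      = u_coord p X Z x + `|zeta_coord Z x| - `|eta_coord q x|].
Proof.
have [p0 q0 Z0] : [/\ p' != 0, q' != 0 & Z' != 0] by rewrite !gt_eqF.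
have eE : eta_coord q' (exchange x) = zeta_coord Z x.
  by rewrite /eta_coord /exchange point3E; field.
have zE : zeta_coord Z' (exchange x) = eta_coord q x.
  by rewrite /zeta_coord /exchange point3E; field.
split=> //; rewrite /u_coord zE /exchange point3E.
by rewrite -/(u_coord p X Z x); field.
Qed.

Lemma exchange_gaps x :
  low_gap p' q' X' Z' (exchange x) = low_gap p q X Z x /\
  high_gap p' X' Z' (exchange x) = high_gap p X Z x.
Proof.
have [eE zE uE] := exchange_coords x.
by rewrite /low_gap /high_gap eE zE uE; split; ring.
Qed.

Lemma exchange_continuous : continuous exchange.
Proof.
apply: row3_continuous => i.
have ze : continuous (fun x => `|zeta_coord Z x|).
  exact: (abs_continuous (@zeta_continuous R Z)).
have ee : continuous (fun x => `|eta_coord q x|).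
  exact: (abs_continuous (@eta_continuous R q)).
have uc := @u_continuous R p X Z.
have /or3P[] : [|| i == 0, i == 1 | i == 2] by case: i => -[|[|[|]]].
- move=> /eqP->.
  rewrite (_ : (fun x => _) = fun x => p' * (u_coord p X Z x + `|zeta_coord Z x|
    - `|eta_coord q x|) + X' * `|eta_coord q x|); last first.
    by apply/funext => x; rewrite /exchange point3E.
  have c1 : continuous (fun x => u_coord p X Z x + `|zeta_coord Z x|).
    by move=> x; exact: (continuousD (uc x) (ze x)).
  have c2 : continuous (fun x => u_coord p X Z x + `|zeta_coord Z x| - `|eta_coord q x|).
    by move=> x; exact: (continuousB (c1 x) (ee x)).
  move=> x; exact: (continuousD (continuousM (@cst_continuous _ _ p' x) (c2 x))
    (continuousM (@cst_continuous _ _ X' x) (ee x))).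
- move=> /eqP->.
  rewrite (_ : (fun x => _) = fun x => q' * zeta_coord Z x); last first.
    by apply/funext => x; rewrite /exchange point3E.
  by move=> x; exact: (continuousM (@cst_continuous _ _ q' x) (@zeta_continuous R Z x)).
- move=> /eqP->.
  rewrite (_ : (fun x => _) = fun x => Z' * eta_coord q x); last first.
    by apply/funext => x; rewrite /exchange point3E.
  by move=> x; exact: (continuousM (@cst_continuous _ _ Z' x) (@eta_continuous R q x)).
Qed.
End exchange.

Section exchange_isometry.
Variables (R : realType) (p q X Z p' q' X' Z' : R).
Hypotheses (p_gt0 : 0 < p) (q_gt0 : 0 < q) (Z_gt0 : 0 < Z).
Hypotheses (p'_gt0 : 0 < p') (q'_gt0 : 0 < q') (Z'_gt0 : 0 < Z').
Local Notation f := (exchange p q X Z p' q' X' Z').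
Local Notation g := (exchange p' q' X' Z' p q X Z).

(** Adding |zeta| - |eta| to u is undone by the same rule once eta and zeta are swapped. *)
Lemma exchangeK : cancel f g.
Proof.
move=> x; have [eE zE uE] := exchange_coords p q X Z X' p'_gt0 q'_gt0 Z'_gt0 x.
have [[x0 x1] x2] := coordE X p_gt0 q_gt0 Z_gt0 x.
by apply: row3P; rewrite {1}/exchange eE zE uE point3E ?x0 ?x1 ?x2 //; ring.
Qed.

(** In the index, [true] selects the non-positive sign of eta, the non-positive sign of zeta and the
    lower sheet. A piece runs on past the edges of the surface, since only one gap is
    constrained. *)
Definition solid_piece (i : bool * bool * bool) : set 'rV[R]_3 :=
  [set x | [/\ `|eta_coord q x| = (-1) ^+ i.1.1 * eta_coord q x,
               `|zeta_coord Z x| = (-1) ^+ i.1.2 * zeta_coord Z x &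
               if i.2 then low_gap p q X Z x = 0 else high_gap p X Z x = 0]].

Lemma closed_eq_continuous (h k : 'rV[R]_3 -> R) :
  continuous h -> continuous k -> closed [set x | h x = k x].
Proof.
move=> ch ck; rewrite (_ : [set x | _] = (fun x => h x - k x) @^-1` [set 0]).
  apply: closed_comp; last exact: closed_eq.
  by move=> x _; exact: (continuousB (ch x) (ck x)).
apply/seteqP; split=> x /=; first by move=> ->; rewrite subrr.
by move/eqP; rewrite subr_eq0 => /eqP.
Qed.

Lemma solid_piece_closed i : closed (solid_piece i).
Proof.
rewrite (_ : solid_piece i =
    [set x | `|eta_coord q x| = (-1) ^+ i.1.1 * eta_coord q x]
    `&` [set x | `|zeta_coord Z x| = (-1) ^+ i.1.2 * zeta_coord Z x]
    `&` [set x | (if i.2 then low_gap p q X Z x else high_gap p X Z x) = 0]).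
  apply: closedI; first apply: closedI; apply: closed_eq_continuous.
  - exact: (abs_continuous (@eta_continuous R q)).
  - move=> x.
    exact: (continuousM (@cst_continuous _ _ (_ : R) x) (@eta_continuous R q x)).
  - exact: (abs_continuous (@zeta_continuous R Z)).
  - move=> x.
    exact: (continuousM (@cst_continuous _ _ (_ : R) x) (@zeta_continuous R Z x)).
  - by case: (i.2); [exact: low_gap_continuous|exact: high_gap_continuous].
  - by move=> x; exact: cst_continuous.
case: i => -[s t] b; apply/seteqP; split=> x; rewrite /solid_piece /=.
  by case: b => -[].
by case: b => -[[]].
Qed.

Lemma solid_piece_cover :
  solid p q X Z `\` open_solid p q X Z `<=` \bigcup_i solid_piece i.
Proof.
move=> x [[l h] nx].
have sgn (a : R) : exists b : bool, `|a| = (-1) ^+ b * a.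
  by case: (ger0P a) => _; [exists false|exists true]; rewrite ?mul1r // mulN1r.
have [s es] := sgn (eta_coord q x); have [t et] := sgn (zeta_coord Z x).
have [lx|l0] := eqVneq (low_gap p q X Z x) 0; first by exists (s, t, true).
have [hx|h0] := eqVneq (high_gap p X Z x) 0; first by exists (s, t, false).
by case: nx; split; rewrite lt_neqAle eq_sym ?l0 ?h0.
Qed.

(** [edge1] and [edge2] match the edges at the origin with their images, and [angle] the inner
    products of a base edge with an apex edge there. Given [edge2], [fold] says that the segment
    from (p,0,0) to an apex has length [q'], half the base side onto which it is carried. *)
Hypotheses (edge1 : p ^+ 2 + q ^+ 2 = X' ^+ 2 + Z' ^+ 2)
  (edge2 : X ^+ 2 + Z ^+ 2 = p' ^+ 2 + q' ^+ 2)
  (angle : p * X = p' * X') (fold : p ^+ 2 + p' ^+ 2 = 2 * (p * X)).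

(** On a piece the signs are constant and u is |eta| or 1 - |zeta|, so the map is affine in |eta|
    and |zeta|. Both squared distances are quadratic forms in the differences of these two, and the
    four identities make the coefficients equal. *)
Lemma exchange_piece_isometry i x y : solid_piece i x -> solid_piece i y ->
  eucl_dist (f x) (f y) = eucl_dist x y.
Proof.
case: i => -[s t] b [ex zx bx] [ey zy by_]; rewrite /eucl_dist.
congr Num.sqrt; rewrite !dotE !row_subE.
rewrite /exchange !point3E !(coordE X p_gt0 q_gt0 Z_gt0).
move: ex zx bx ey zy by_; rewrite /low_gap /high_gap /=.
move: (u_coord p X Z x) (u_coord p X Z y) => u u'.
have sgn (a : R) (c : bool) : `|a| = (-1) ^+ c * a -> a = (-1) ^+ c * `|a|.
  by move=> ->; rewrite mulrA -signr_addb addbb mul1r.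
move=> /sgn ex /sgn zx bx /sgn ey /sgn zy by_.
(* The identities are solved for the squares of [q], [Z] and [p], so that rewriting eliminates these
   before [ring]. *)
have e5 : q ^+ 2 = X' ^+ 2 + Z' ^+ 2 - p ^+ 2 by rewrite -edge1; ring.
have e6 : Z ^+ 2 = p' ^+ 2 + q' ^+ 2 - X ^+ 2 by rewrite -edge2; ring.
have e7 : p ^+ 2 = 2 * (p' * X') - p' ^+ 2 by rewrite -angle -fold; ring.
move: (eta_coord q x) (eta_coord q y) (zeta_coord Z x) (zeta_coord Z y)
  ex ey zx zy bx by_ => e e' z z'.
move: `|e| `|e'| `|z| `|z'| => a a' c c' -> -> -> ->.
have s2 : (-1) ^+ s * (-1) ^+ s = 1 :> R by rewrite -signr_addb addbb.
have t2 : (-1) ^+ t * (-1) ^+ t = 1 :> R by rewrite -signr_addb addbb.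
move: ((-1) ^+ s) ((-1) ^+ t) s2 t2 => S T s2 t2.
case: b => bx by_.
  have -> : u = a by lra.
  have -> : u' = a' by lra.
  transitivity ((p' * (c - c') + X' * (a - a')) ^+ 2
    + q' ^+ 2 * (T * T) * (c - c') ^+ 2 + Z' ^+ 2 * (S * S) * (a - a') ^+ 2).
    by ring.
  transitivity ((p * (a - a')) ^+ 2 + 2 * (p * X) * (a - a') * (c - c')
     + (X * (c - c')) ^+ 2
    + q ^+ 2 * (S * S) * (a - a') ^+ 2 + Z ^+ 2 * (T * T) * (c - c') ^+ 2).
    by rewrite s2 t2 e5 e6 angle; ring.
  by ring.
have -> : u = 1 - c by lra.
have -> : u' = 1 - c' by lra.
transitivity (((X' - p') * (a - a')) ^+ 2
  + q' ^+ 2 * (T * T) * (c - c') ^+ 2 + Z' ^+ 2 * (S * S) * (a - a') ^+ 2).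
  by ring.
transitivity ((X ^+ 2 - 2 * (p * X) + p ^+ 2) * (c - c') ^+ 2
  + q ^+ 2 * (S * S) * (a - a') ^+ 2 + Z ^+ 2 * (T * T) * (c - c') ^+ 2).
  by rewrite s2 t2 e5 e6 angle e7; ring.
by ring.
Qed.

End exchange_isometry.

Lemma exchange_isometric (R : realType) (p q X Z p' q' X' Z' : R) :
  0 < p -> 0 < q -> 0 < Z -> 0 < p' -> 0 < q' -> 0 < Z' ->
  p ^+ 2 + q ^+ 2 = X' ^+ 2 + Z' ^+ 2 -> X ^+ 2 + Z ^+ 2 = p' ^+ 2 + q' ^+ 2 ->
  p * X = p' * X' -> p ^+ 2 + p' ^+ 2 = 2 * (p * X) ->
  intrinsically_isometric (solid p q X Z `\` open_solid p q X Z)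
    (solid p' q' X' Z' `\` open_solid p' q' X' Z').
Proof.
move=> p0 q0 Z0 p'0 q'0 Z'0 e1 e2 e3 e4.
pose f := exchange p q X Z p' q' X' Z'.
have fS x : (solid p' q' X' Z' `\` open_solid p' q' X' Z') (f x)
    <-> (solid p q X Z `\` open_solid p q X Z) x.
  rewrite /setD /solid /open_solid /=.
  by have [-> ->] := exchange_gaps p q X Z X' p'0 q'0 Z'0 x.
pose h := exchange p' q' X' Z' p q X Z.
have fK : cancel f h by exact: exchangeK.
have hK : cancel h f by exact: exchangeK.
exists f; split.
  split.
  - by move=> x /fS.
  - by move=> x y _ _; exact: (can_inj fK).
  - move=> y Sy; exists (h y); last exact: hK.
    by apply: (fS (h y)).1; rewrite hK; exact: Sy.
move=> a b g _ [cg Sg]; split.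
  split; last by move=> t tab; apply/fS; exact: Sg.
  by apply: within_continuous_comp cg => z _; exact: exchange_continuous.
apply: (piecewise_isometry_curve_length (C := solid_piece p q X Z)
  (p := solid p q X Z `\` open_solid p q X Z)).
- exact: solid_piece_closed.
- exact: solid_piece_cover.
- by move=> i x y; exact: exchange_piece_isometry.
- by split.
Qed.

(** * Measurability, and volume bounds by inscribed and circumscribed boxes *)

Section volume.
Variable R : realType.

Definition box (a b : R * R * R) : set (R * R * R) :=
  (`]a.1.1, b.1.1[ `*` `]a.1.2, b.1.2[) `*` `]a.2, b.2[.

Lemma measurable_box a b : measurable (box a b).
Proof. by apply: measurableX; [apply: measurableX|]; exact: measurable_itv. Qed.

Lemma measure_box a b :
  a.1.1 <= b.1.1 -> a.1.2 <= b.1.2 -> a.2 <= b.2 ->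
  (((@lebesgue_measure R \x @lebesgue_measure R) \x @lebesgue_measure R)
     (box a b) = ((b.1.1 - a.1.1) * (b.1.2 - a.1.2) * (b.2 - a.2))%:E)%E.
Proof.
have itv (x y : R) : x <= y -> (lebesgue_measure (`]x, y[%classic : set R) = (y - x)%:E)%E.
  move=> xy; rewrite lebesgue_measure_itv /= lte_fin; case: ltP => [_|yx].
    by rewrite EFinB.
  by congr EFin; apply/eqP; rewrite eq_sym subr_eq0 eq_le yx xy.
move=> ab1 ab2 ab3; rewrite /box.
have E1 := product_measure1E (@lebesgue_measure R) (@lebesgue_measure R)
  (@measurable_itv R `]a.1.1, b.1.1[) (@measurable_itv R `]a.1.2, b.1.2[).
have m12 : measurable (`]a.1.1, b.1.1[ `*` `]a.1.2, b.1.2[ : set (R * R)).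
  by apply: measurableX; exact: measurable_itv.
have E2 := product_measure1E (@lebesgue_measure R \x @lebesgue_measure R)%E
  (@lebesgue_measure R) m12 (@measurable_itv R `]a.2, b.2[).
transitivity ((@lebesgue_measure R `]a.1.1, b.1.1[%classic
  * @lebesgue_measure R `]a.1.2, b.1.2[%classic)
  * @lebesgue_measure R `]a.2, b.2[%classic)%E; last by rewrite !itv // -!EFinM.
by rewrite -E1; exact: E2.
Qed.

Variables (p q X Z : R).

Let measurable_abs_eta : measurable_fun setT (fun x : R * R * R => `|x.1.2 / q|).
Proof.
apply: measurableT_comp; first exact: normr_measurable.
apply: measurable_funM; last exact: measurable_cst.
exact: (measurableT_comp measurable_snd measurable_fst).
Qed.

Let measurable_abs_zeta : measurable_fun setT (fun x : R * R * R => `|x.2 / Z|).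
Proof.
apply: measurableT_comp; first exact: normr_measurable.
by apply: measurable_funM; [exact: measurable_snd|exact: measurable_cst].
Qed.

Let measurable_u :
  measurable_fun setT (fun x : R * R * R => (x.1.1 - X * `|x.2 / Z|) / p).
Proof.
apply: measurable_funM; last exact: measurable_cst.
apply: measurable_funB.
  exact: (measurableT_comp measurable_fst measurable_fst).
by apply: measurable_funM; [exact: measurable_cst|exact: measurable_abs_zeta].
Qed.

Lemma low_gap_measurable :
  measurable_fun setT (low_gap p q X Z \o @point3 R).
Proof.
rewrite (_ : _ \o _ = fun x : R * R * R =>
  (x.1.1 - X * `|x.2 / Z|) / p - `|x.1.2 / q|); last first.
  by apply/funext => -[[x y] z]; rewrite /= /low_gap /u_coord /eta_coord /zeta_coord !point3E.
apply: measurable_funB; last exact: measurable_abs_eta.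
exact: measurable_u.
Qed.

Lemma high_gap_measurable :
  measurable_fun setT (high_gap p X Z \o @point3 R).
Proof.
rewrite (_ : _ \o _ = fun x : R * R * R =>
  1 - `|x.2 / Z| - (x.1.1 - X * `|x.2 / Z|) / p); last first.
  by apply/funext => -[[x y] z]; rewrite /= /high_gap /u_coord /zeta_coord !point3E.
apply: measurable_funB; last exact: measurable_u.
by apply: measurable_funB; [exact: measurable_cst|exact: measurable_abs_zeta].
Qed.

Lemma open_solid_measurable : measurable (@point3 R @^-1` open_solid p q X Z).
Proof.
rewrite (_ : _ @^-1` _ =
   (setT `&` (low_gap p q X Z \o @point3 R) @^-1` `]0, +oo[)
   `&` (setT `&` (high_gap p X Z \o @point3 R) @^-1` `]0, +oo[)).
  apply: measurableI.
    by apply: low_gap_measurable => //; exact: measurable_itv.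
  by apply: high_gap_measurable => //; exact: measurable_itv.
rewrite !setTI; apply/seteqP; split=> x; rewrite /open_solid /= !in_itv /= !andbT.
  by case.
by case.
Qed.

Lemma le_lebesgue3_open_solid a b :
  a.1.1 <= b.1.1 -> a.1.2 <= b.1.2 -> a.2 <= b.2 ->
  box a b `<=` @point3 R @^-1` open_solid p q X Z ->
  (((b.1.1 - a.1.1) * (b.1.2 - a.1.2) * (b.2 - a.2))%:E
     <= lebesgue3 (open_solid p q X Z))%E.
Proof.
move=> ab1 ab2 ab3 sub; rewrite -measure_box //.
apply: le_measure => //; rewrite inE; first exact: measurable_box.
exact: open_solid_measurable.
Qed.

Lemma ge_lebesgue3_open_solid a b :
  a.1.1 <= b.1.1 -> a.1.2 <= b.1.2 -> a.2 <= b.2 ->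
  @point3 R @^-1` open_solid p q X Z `<=` box a b ->
  (lebesgue3 (open_solid p q X Z)
     <= ((b.1.1 - a.1.1) * (b.1.2 - a.1.2) * (b.2 - a.2))%:E)%E.
Proof.
move=> ab1 ab2 ab3 sub; rewrite -measure_box //.
apply: le_measure => //; rewrite inE; last exact: measurable_box.
exact: open_solid_measurable.
Qed.
End volume.

(** * The bipyramids, and explicit bounds for their volumes *)

Section bipyramids.
Variables (R : realType) (p q X Z : R).
Hypotheses (p_gt0 : 0 < p) (q_gt0 : 0 < q) (Z_gt0 : 0 < Z).
Hypotheses (X_gt0 : 0 < X) (Xp : X != p).

Definition bip : bipyramid R :=
  Bipyramid (bip_realizes p_gt0 q_gt0 Z_gt0 (lt0r_neq0 X_gt0) Xp).

Lemma surface_bip : surface bip = solid p q X Z `\` open_solid p q X Z.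
Proof. exact: union_hull_faces. Qed.

Lemma volume_bip : volume (surface bip) = lebesgue3 (open_solid p q X Z).
Proof. by rewrite /volume surface_bip enclosed_solid. Qed.

(** The base centroid has first coordinate 2p/3, while every point of the line through the apexes
    has first coordinate [X]. *)
Lemma oblique_bip : 3 * X != 2 * p -> oblique bip.
Proof.
move=> Xp32 [_ [t]] /(congr1 (fun x : 'rV[R]_3 => x 0 0)).
rewrite !(row_scaleE, row_subE, row_addE) sum_ord3 !row_addE.
rewrite /apex /base /= /bip_vertex /= !point3E => e.
by move/eqP: Xp32; apply; lra.
Qed.
End bipyramids.

Section explicit_volumes.
Variables (R : realType) (Z : R).
Hypothesis Z_gt0 : 0 < Z.

Let abs_div_lt (a b k : R) : 0 < k -> - (b * k) < a < b * k -> `|a / k| < b.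
Proof.
by move=> k0 h; rewrite normrM normfV (gtr0_norm k0) ltr_pdivrMr // ltr_norml.
Qed.

(** The first coordinate 8u + 5|zeta| lies between 0 and 13, which gives a box of volume 13 * 20 *
    2Z. *)
Lemma thin_volume_le :
  (lebesgue3 (open_solid 8 10 5 Z) <= (520 * Z)%:E)%E.
Proof.
have Z0 := Z_gt0.
have := @ge_lebesgue3_open_solid R 8 10 5 Z (0, - 10, - Z) (13, 10, Z).
rewrite /= (_ : (13 - 0) * (10 - - 10) * (Z - - Z) = 520 * Z); last by ring.
apply; [lra..|].
move=> [[x y] z] /= /open_solid_bounds[/andP[u0 u1]].
have [[x0 x1] x2] := @coordE R 8 10 5 Z ltac:(lra) ltac:(lra) Z_gt0 (point3 (x, y, z)).
move: x0 x1 x2 u0 u1; rewrite !point3E.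
move: (u_coord _ _ _ _) (eta_coord _ _) (zeta_coord _ _) => u e f -> -> -> u0 u1.
rewrite ltr_norml => /andP[e1 e2] f1; have := normr_ge0 f => f0.
move: (f1); rewrite ltr_norml => /andP[f2 f3].
have ZZ1 : Z * f < Z * 1 by rewrite ltr_pM2l.
have ZZ2 : Z * -1 < Z * f by rewrite ltr_pM2l.
rewrite /box /= !in_itv /=; split; [split|]; apply/andP; split; lra.
Qed.

(** In the inscribed box |eta| < 1/10 and |zeta| < 1/8, whereas u stays between 19/64 and 1/2. *)
Lemma thin_volume_gt0 : (0 < lebesgue3 (open_solid 8 10 5 Z))%E.
Proof.
have Z0 := Z_gt0.
have := @le_lebesgue3_open_solid R 8 10 5 Z (3, - 1, - (Z / 8)) (4, 1, Z / 8).
rewrite /= (_ : (4 - 3) * (1 - - 1) * (Z / 8 - - (Z / 8)) = Z / 2); last by field.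
move=> le_vol; apply: lt_le_trans (le_vol _ _ _ _); [|lra..|].
  by rewrite lte_fin divr_gt0.
move=> [[x y] z] /= [[]]; rewrite /= !in_itv /= => /andP[x3 x4] /andP[y1 y2] /andP[z1 z2].
have yl : `|y / 10| < 1 / 10 by apply: abs_div_lt; [|apply/andP; split]; lra.
have zl : `|z / Z| < 1 / 8 by apply: abs_div_lt; [|apply/andP; split]; lra.
have := normr_ge0 (z / Z).
rewrite /open_solid /low_gap /high_gap /u_coord /eta_coord /zeta_coord /= !point3E.
by move=> ?; split; lra.
Qed.

(** A unit box fits for every such [q]: there |eta| < 1/6 and |zeta| < 1/16, whereas u stays between
    11/32 and 3/4. *)
Lemma fat_volume_ge (q : R) : 3 <= q ->
  (1%:E <= lebesgue3 (open_solid 4 q 10 8))%E.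
Proof.
move=> q3.
have := @le_lebesgue3_open_solid R 4 q 10 8 (2, - 2^-1, - 2^-1) (3, 2^-1, 2^-1).
rewrite /= (_ : (3 - 2) * (2^-1 - - 2^-1) * (2^-1 - - 2^-1) = 1); last by field.
apply; [lra..|].
move=> [[x y] z] /= [[]]; rewrite /= !in_itv /= => /andP[x3 x4] /andP[y1 y2] /andP[z1 z2].
have yl : `|y / q| < 1 / 6 by apply: abs_div_lt; [|apply/andP; split]; lra.
have zl : `|z / 8| < 1 / 16 by apply: abs_div_lt; [|apply/andP; split]; lra.
have := normr_ge0 (z / 8).
rewrite /open_solid /low_gap /high_gap /u_coord /eta_coord /zeta_coord /= !point3E.
by move=> ?; split; lra.
Qed.
End explicit_volumes.

Theorem theorem1 (R : realType) (c : R) (hc : 0 < c) :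
  exists P Q : bipyramid R,
    [/\ oblique P /\ oblique Q,
        convex_surface (surface P) /\ (0 < volume (surface P))%E,
        ~ convex_surface (surface Q) /\
          intrinsically_isometric (surface P) (surface Q)
      & (c%:E * volume (surface P) < volume (surface Q))%E].
Proof.
(* This makes [c * (520 * Z)] equal to c/(c+1), which is below the lower bound 1 for the second
   volume. *)
pose Z := (520 * (c + 1))^-1.
have Z0 : 0 < Z by rewrite invr_gt0; lra.
have cZ : c * (520 * Z) < 1.
  by rewrite mulrA ltr_pdivrMr; lra.
have pos n : 0 < n.+1%:R :> R by rewrite ltr0n.
(* Forced by the second edge identity, [5 ^+ 2 + Z ^+ 2 = 4 ^+ 2 + q ^+ 2]. *)
pose q := Num.sqrt (9 + Z ^+ 2).
have q2 : q ^+ 2 = 9 + Z ^+ 2 by rewrite sqr_sqrtr // addr_ge0 // sqr_ge0.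
have q3 : 3 <= q.
  rewrite -(@ler_pXn2r _ 2) ?nnegrE ?sqrtr_ge0 // q2.
  by have := sqr_ge0 Z; lra.
have q0 : 0 < q by lra.
have nP : (5 : R) != 8 by lra.
have nQ : (10 : R) != 4 by lra.
(* [pos n] is positivity of n + 1, and the parameters come in the order p, q, Z, X: here 8, 10, [Z],
   5, and then 4, [q], 8, 10. *)
exists (bip (pos 7%N) (pos 9%N) Z0 (pos 4%N) nP).
exists (bip (pos 3%N) q0 (pos 7%N) (pos 9%N) nQ).
rewrite !volume_bip !surface_bip; split.
- by split; apply: oblique_bip; lra.
- by split; [apply: convex_solid_surface => //; lra|exact: thin_volume_gt0].
- split; first by apply: nonconvex_solid_surface => //; lra.
  by apply: exchange_isometric => //; rewrite ?q2; ring.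
apply: lt_le_trans (fat_volume_ge q3).
apply: le_lt_trans (_ : (c * (520 * Z))%:E < _)%E; last by rewrite lte_fin.
by rewrite EFinM lee_pmul2l //; exact: thin_volume_le.
Qed.
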